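(* Let $G$ be a finite group. If $p>5$ is a prime and $G$ has a subgroup isomorphic to $C_p\times C_p$, then $G$ is not Cay-DS. If $G$ has a subgroup isomorphic to $C_5\times C_5$, then $G$ is not DS.
   Context: For a finite group $G$ and a subset $S\subseteq G\setminus\{1\}$ with $S=S^{-1}$, the Cayley graph $Cay(G,S)$ has vertex set $G$, with $a,b$ adjacent iff $ab^{-1}\in S$. The spectrum of a graph is the multiset of eigenvalues of its adjacency matrix. A finite group $G$ is DS if every Cayley graph $\Gamma$ on $G$ is isomorphic to every (finite simple) graph $\Gamma'$ with the same spectrum; $G$ is Cay-DS if every Cayley graph $\Gamma$ on $G$ is isomorphic to every Cayley graph $\Gamma'$ (on any finite group) with the same spectrum. $C_n$ is the cyclic group of order $n$. *)

(* Defs.v *)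
From HB Require Import structures.
From mathcomp Require Import all_boot all_order all_algebra all_fingroup all_field.
Set Implicit Arguments.
Unset Strict Implicit.
Unset Printing Implicit Defensive.
Import GRing.Theory.

(* A finite simple graph is a symmetric irreflexive relation on a finType. *)
Definition simple_graph (T : finType) (e : rel T) : Prop :=
  symmetric e /\ irreflexive e.

Definition graph_iso (T T' : finType) (e : rel T) (e' : rel T') : Prop :=
  exists2 f : T -> T', bijective f & {mono f : x y / e x y >-> e' x y}.

Section Spectrum.
Local Open Scope ring_scope.

Definition adjmx (T : finType) (e : rel T) : 'M[algC]_#|T| :=
  \matrix_(i, j) (e (enum_val i) (enum_val j))%:R.

(* The eigenvalues listed with multiplicity, i.e., the roots of the
   characteristic polynomial; the order of the list is irrelevant, and lists
   are only ever compared up to perm_eq. *)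
Definition spectrum (T : finType) (e : rel T) : seq algC :=
  sval (closed_field_poly_normal (char_poly (adjmx e))).

Lemma spectrum_char_poly (T : finType) (e : rel T) :
  char_poly (adjmx e) = \prod_(a <- spectrum e) ('X - a%:P).
Proof.
rewrite /spectrum; case: closed_field_poly_normal => r /= {1}->.
by rewrite (monicP (char_poly_monic _)) scale1r.
Qed.

Lemma mem_spectrum (T : finType) (e : rel T) (a : algC) :
  (a \in spectrum e) = eigenvalue (adjmx e) a.
Proof. by rewrite eigenvalue_root_char spectrum_char_poly root_prod_XsubC. Qed.

Lemma size_spectrum (T : finType) (e : rel T) : size (spectrum e) = #|T|.
Proof.
by have := size_char_poly (adjmx e); rewrite spectrum_char_poly size_prod_XsubC => -[].
Qed.

End Spectrum.

Definition cospectral (T T' : finType) (e : rel T) (e' : rel T') : bool :=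
  perm_eq (spectrum e) (spectrum e').

Section Cayley.
Local Open Scope group_scope.

Definition cayley_set (G : finGroupType) (S : {set G}) : Prop :=
  1 \notin S /\ S = S^-1.

Definition Cay (G : finGroupType) (S : {set G}) : rel G :=
  [rel a b | a * b^-1 \in S].

Lemma Cay_simple (G : finGroupType) (S : {set G}) :
  cayley_set S -> simple_graph (Cay S).
Proof.
move=> [S1 SV]; rewrite /Cay; split=> [a b | a] /=; last by rewrite mulgV (negPf S1).
by rewrite [in LHS]SV mem_invg invMg invgK.
Qed.

End Cayley.

Definition DS (G : finGroupType) : Prop :=
  forall S : {set G}, cayley_set S ->
  forall (T : finType) (e : rel T), simple_graph e ->
  cospectral (Cay S) e -> graph_iso (Cay S) e.

Definition Cay_DS (G : finGroupType) : Prop :=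
  forall S : {set G}, cayley_set S ->
  forall (G' : finGroupType) (S' : {set G'}), cayley_set S' ->
  cospectral (Cay S) (Cay S') -> graph_iso (Cay S) (Cay S').

(* Main.v *)
Require Import Defs.
From HB Require Import structures.
From mathcomp Require Import all_boot all_order all_algebra all_fingroup all_field.
From mathcomp Require Import ring.

(** Identify the subgroup H with F_p^2.  The union of m of its p + 1 lines
    through 0, minus 0, is the connection set of a Cayley graph on G that
    consists of |G : H| copies of the graph of an m-net of order p.  If [A] is
    the adjacency matrix and [M_i] the matrix of the i-th parallelism, then
    A + m = sum_i M_i, M_i^2 = p M_i, and M_i M_j is the matrix J of "same
    component" for i <> j.  Hence [A] is killed by a cubic with distinct roots,
    and its spectrum only depends on |G|, m and p: all such graphs, including
    the graphs of Latin squares (m = 3), are cospectral.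

    The number of common neighbours of a triangle tells them apart.  For p > 5
    take four lines: if their cross-ratio is harmonic, every triangle has at
    least four common neighbours (p - 3 of them on its line if it is collinear;
    otherwise because it can be completed to a parallelogram whose diagonals are
    lines of the net); for the slopes infinity, 0, 1, 3 some triangle has only
    three.  For p = 5 compare the Cayley
    table of C_5 with a Latin square of order 5 that contains a 2 x 2 subsquare:
    the latter has a triangle with exactly one common neighbour, the former does
    not. *)

Set Implicit Arguments.
Unset Strict Implicit.
Unset Printing Implicit Defensive.
Import GRing.Theory Num.Theory.

(** * Spectra of matrices annihilated by a cubic with distinct roots *)

Section SpectrumFromTraces.
Local Open Scope ring_scope.

Lemma char_poly_conj (F : fieldType) n (P D : 'M[F]_n) :
  P \in unitmx -> char_poly (invmx P *m D *m P) = char_poly D.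
Proof.
move=> Pu; pose Q := map_mx (@polyC F) P.
have Qu : Q \in unitmx by rewrite map_unitmx.
have -> : char_poly (invmx P *m D *m P) = \det (invmx Q *m char_poly_mx D *m Q).
  congr (\det _); rewrite /char_poly_mx mulmxBr mulmxBl.
  rewrite !map_mxM map_invmx (scalar_mxC _ (invmx Q)) -[X in _ = X - _]mulmxA.
  by rewrite mulVmx ?mulmx1.
by rewrite !det_mulmx mulrAC -det_mulmx mulVmx // det1 mul1r.
Qed.

(** The quadratic vanishes at [b] and [c], so only the entries equal to [a] contribute, each by the
    same constant. *)
Lemma sum_quadratic_count (F : comNzRingType) (a b c : F) (s : seq F) :
  uniq [:: a; b; c] -> all (mem [:: a; b; c]) s ->
  \sum_(x <- s) (x - b) * (x - c) = (count_mem a s)%:R * ((a - b) * (a - c)).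
Proof.
rewrite /= !inE negb_or => /and3P[/andP[ab ac] bc _].
elim: s => [|x s IHs] /=; first by rewrite big_nil mul0r.
move=> /andP[xabc /IHs sE]; rewrite big_cons sE natrD [RHS]mulrDl; congr (_ + _).
move: xabc; rewrite !inE; have [->|xa] := eqVneq x a; first by rewrite mul1r.
by move=> /= /orP[]/eqP->; rewrite subrr ?mulr0 !mul0r.
Qed.

(** The sum of (x - b)(x - c) is a combination of the length, the sum and the sum of squares; in
    characteristic 0 it determines the multiplicity of [a]. *)
Lemma eq_count_power_sums (F : numDomainType) (a b c : F) (s t : seq F) :
  uniq [:: a; b; c] -> all (mem [:: a; b; c]) s -> all (mem [:: a; b; c]) t ->
  size s = size t -> \sum_(x <- s) x = \sum_(x <- t) x ->
  \sum_(x <- s) x ^+ 2 = \sum_(x <- t) x ^+ 2 -> count_mem a s = count_mem a t.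
Proof.
move=> abcU sabc tabc sz eq1 eq2.
have sumE (r : seq F) : \sum_(x <- r) (x - b) * (x - c) =
    \sum_(x <- r) x ^+ 2 - (b + c) * \sum_(x <- r) x + (size r)%:R * (b * c).
  elim: r => [|x r IHr]; first by rewrite !big_nil /=; ring.
  by rewrite !big_cons IHr /= -natr1; ring.
have [ab ac] : a - b != 0 /\ a - c != 0.
  by move: abcU; rewrite /= !inE negb_or !subr_eq0 => /andP[/andP[]].
apply/eqP; rewrite -(eqr_nat F).
have abac : (a - b) * (a - c) != 0 by rewrite mulf_neq0.
rewrite -(inj_eq (mulIf abac)) -!sum_quadratic_count //.
by rewrite !sumE sz eq1 eq2.
Qed.

Lemma perm_eq_power_sums (F : numDomainType) (a b c : F) (s t : seq F) :
  uniq [:: a; b; c] -> all (mem [:: a; b; c]) s -> all (mem [:: a; b; c]) t ->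
  size s = size t -> \sum_(x <- s) x = \sum_(x <- t) x ->
  \sum_(x <- s) x ^+ 2 = \sum_(x <- t) x ^+ 2 -> perm_eq s t.
Proof.
move=> abcU sabc tabc sz eq1 eq2; apply/allP => x; rewrite mem_cat => xst.
have: x \in [:: a; b; c] by case/orP: xst; apply: (allP _).
(* The hypotheses are invariant under rotation of the triple, so the count for [a] also yields those
   for [b] and [c]. *)
have rotE i r : all (mem (rot i [:: a; b; c])) r = all (mem [:: a; b; c]) r.
  by apply: eq_all => y; apply: mem_rot.
rewrite !inE => /or3P[]/eqP-> /=; apply/eqP.
- exact: (@eq_count_power_sums _ a b c).
- by apply: (@eq_count_power_sums _ b c a);
  rewrite -?[[:: b; c; a]]/(rot 1 [:: a; b; c]) ?rot_uniq ?rotE.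
- by apply: (@eq_count_power_sums _ c a b);
  rewrite -?[[:: c; a; b]]/(rot 2 [:: a; b; c]) ?rot_uniq ?rotE.
Qed.

(** The minimal polynomial divides a product of distinct linear factors, so [A] is diagonalizable;
    [s] is the diagonal. *)
Lemma diagonal_of_cubic (F : fieldType) n (A : 'M[F]_n) (a b c : F) :
  uniq [:: a; b; c] ->
  (A - a%:M) *m (A - b%:M) *m (A - c%:M) = 0 ->
  exists s : seq F, [/\ size s = n, all (mem [:: a; b; c]) s,
    char_poly A = \prod_(x <- s) ('X - x%:P),
    \tr A = \sum_(x <- s) x & \tr (A *m A) = \sum_(x <- s) x ^+ 2].
Proof.
case: n A => [|n] A abcU annul.
  exists [::]; split; rewrite ?big_nil ?/mxtrace ?big_ord0 //.
  by rewrite /char_poly det_mx00.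
have /diagonalizableP[P Pu] : exists2 rs, uniq rs & mxminpoly A %| \prod_(x <- rs) ('X - x%:P).
  exists [:: a; b; c] => //; apply: mxminpoly_min.
  rewrite !big_cons big_nil mulr1 !rmorphM !rmorphB /= horner_mx_X !horner_mx_C.
  by rewrite mulrA.
move=> /(diagonalizable_forLR Pu)[d AE0].
have AE : A = invmx P *m diag_mx d *m P by rewrite -conjVmx.
have conjM (D E : 'M_n.+1) :
    (invmx P *m D *m P) *m (invmx P *m E *m P) = invmx P *m (D *m E) *m P.
  by rewrite -!mulmxA (mulmxA P) mulmxV // mul1mx.
have conjB x : A - x%:M = invmx P *m (diag_mx d - x%:M) *m P.
  by rewrite mulmxBr mulmxBl -AE (scalar_mxC x (invmx P)) -[X in _ = _ - X]mulmxA mulVmx ?mulmx1.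
have trE (D : 'M_n.+1) : \tr (invmx P *m D *m P) = \tr D.
  by rewrite mxtrace_mulC mulmxA mulmxV ?mul1mx.
have diagB x : diag_mx d - x%:M = diag_mx (d - const_mx x).
  by rewrite -diag_const_mx -raddfB.
exists [seq d 0 i | i : 'I_n.+1]; split.
- by rewrite size_map size_enum_ord.
- apply/allP => _ /mapP[i _ ->]; rewrite /= !inE.
  (* Conjugated back, the diagonal of the annihilation equation says that each entry is one of the
     three roots. *)
  have /(congr1 (fun D => P *m D *m invmx P)) := annul.
  rewrite !conjB !conjM !diagB !mulmx_diag mulmx0 mul0mx -!mulmxA mulmxV // mulmx1 mulmxA mulmxV //.
  move=> /matrixP/(_ i i); rewrite mul1mx !mxE eqxx mulr1n => /eqP.
  by rewrite !mulf_eq0 !subr_eq0 orbA.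
- rewrite AE char_poly_conj // char_poly_trig ?diag_mx_is_trig // big_map big_enum /=.
  by apply: eq_bigr => i _; rewrite !mxE eqxx.
- by rewrite AE trE mxtrace_diag big_map big_enum.
- rewrite AE conjM trE mulmx_diag mxtrace_diag big_map big_enum.
  by apply: eq_bigr => i _; rewrite mxE.
Qed.

(** Three multiplicities are determined by the dimension and the traces of the matrix and its
    square. *)
Lemma cospectral_cubic (T : finType) (e e' : rel T) (a b c : algC) :
  let annul r := (adjmx r - a%:M) *m (adjmx r - b%:M) *m (adjmx r - c%:M) in
  uniq [:: a; b; c] -> annul e = 0 -> annul e' = 0 ->
  \tr (adjmx e) = \tr (adjmx e') ->
  \tr (adjmx e *m adjmx e) = \tr (adjmx e' *m adjmx e') ->
  cospectral e e'.
Proof.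
move=> annul abcU /(diagonal_of_cubic abcU)[s [sz sabc chE -> ->]].
move=> /(diagonal_of_cubic abcU)[t [tz tabc chE' -> ->]] eq1 eq2.
have st := perm_eq_power_sums abcU sabc tabc (etrans sz (esym tz)) eq1 eq2.
by apply/prod_XsubC_eq; rewrite -!spectrum_char_poly chE chE'; apply: perm_big.
Qed.
End SpectrumFromTraces.

(** * Adjacency algebra of the graph of a net *)

Section NetGraph.
Local Open Scope ring_scope.

Lemma adjmxE (T : finType) (r : rel T) i j :
  adjmx r i j = (r (enum_val i) (enum_val j))%:R.
Proof. exact: mxE. Qed.

Lemma adjmx_mul (T : finType) (r s : rel T) : adjmx r *m adjmx s =
  \matrix_(i, j) #|[pred z | r (enum_val i) z && s z (enum_val j)]|%:R.
Proof.
apply/matrixP => i j; rewrite !mxE -[in RHS]sum1_card natr_sum.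
under [LHS]eq_bigr do rewrite !adjmxE -natrM mulnb.
rewrite (reindex enum_rank) /=; last first.
  by apply: onW_bij; exists enum_val; [exact: enum_rankK|exact: enum_valK].
by rewrite [RHS]big_mkcond; apply: eq_bigr => z _; rewrite enum_rankK inE; case: ifP.
Qed.

Variables (T : finType) (C : eqType) (c : T -> C) (I K : finType) (f : I -> T -> K).

(* A net on each fibre of [c]: points are the elements of the fibre, and the
   lines of the parallel class [i] are the level sets of [f i]. *)
Definition is_net := forall i j, i != j -> forall x a b,
  #|[pred z | [&& c z == c x, f i z == a & f j z == b]]| = 1%N.

Definition net_graph : rel T :=
  [rel x y | [&& x != y, c x == c y & [exists i, f i x == f i y]]].

Hypotheses (netf : is_net) (I_gt1 : (1 < #|I|)%N).

(** This relation is reflexive: each class contributes 1 to the diagonal, whence the shift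
    [A + m%:M]. *)
Let par i : rel T := [rel x y | (c x == c y) && (f i x == f i y)].
Let m : algC := #|I|%:R.
Let q : algC := #|K|%:R.
Let M i := adjmx (par i).
Let J := adjmx [rel x y | c x == c y].
Let A := adjmx net_graph.

Let other_class (i : I) : exists j, i != j.
Proof.
apply/existsP; apply: contraLR I_gt1; rewrite negb_exists -leqNgt => /forallP all_i.
by apply/card_le1_eqP => j k _ _; move/eqP: (negbNE (all_i j)) => <-; move/eqP: (negbNE (all_i k)).
Qed.

Let net_inj i j x y : i != j -> par i x y -> par j x y -> x = y.
Proof.
move=> ij /andP[/eqP cxy /eqP fi] /andP[_ /eqP fj].
have /card_le1_eqP := eq_leq (netf ij x (f i x) (f j x)); apply; rewrite inE ?eqxx //.
by rewrite cxy fi fj !eqxx.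
Qed.

(** Inside its fibre, a line of class [i] meets each of the [#|K|] lines of another class in one
    point. *)
Let card_line i x : #|[pred z | par i x z]| = #|K|.
Proof.
have [j ij] := other_class i.
rewrite -sum1_card (partition_big (f j) predT) //= -sum1_card; apply: eq_bigr => b _.
rewrite sum1_card -(netf ij x (f i x) b); apply: eq_card => z.
by rewrite [LHS]unfold_in !inE /= -andbA [c z == _]eq_sym [f i z == _]eq_sym.
Qed.

(** Distinct points lie on at most one common line, while a point shares its lines of all [m]
    classes with itself. *)
Let sum_par x y : \sum_i (par i x y)%:R = (net_graph x y)%:R + m *+ (x == y).
Proof.
rewrite /par /net_graph /=; have [<-|xy] /= := eqVneq x y.
  rewrite add0r mulr1n /m -sum1_card natr_sum.
  by apply: eq_bigr => i _; rewrite !eqxx.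
rewrite mulr0n addr0; case: eqP => [cxy|] /=; last by rewrite big1.
case: existsP => [[i fi]|nex]; last first.
  by rewrite big1 // => i _; case: eqP => // fi; case: nex; exists i; apply/eqP.
rewrite (bigD1 i) //= fi big1 ?addr0 // => j ji; case: eqP => // fj.
by case/eqP: xy; apply: (net_inj ji); rewrite /par /= cxy ?fj ?(eqP fi) !eqxx.
Qed.

Let sumM : \sum_i M i = A + m%:M.
Proof.
apply/matrixP => a b; rewrite summxE !mxE -(inj_eq enum_val_inj) -sum_par.
by apply: eq_bigr => i _; apply: adjmxE.
Qed.

(** For two points of one fibre, the [i]-line of the first and the [j]-line of the second meet in
    exactly one point. *)
Let MM i j : i != j -> M i *m M j = J.
Proof.
move=> ij; rewrite adjmx_mul; apply/matrixP => a b; rewrite !mxE /=.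
set x := enum_val a; set y := enum_val b.
case: (eqVneq (c x) (c y)) => cxy; last first.
  rewrite eq_card0 // => z; rewrite !inE; apply/negP => /andP[/andP[/eqP cxz _] /andP[/eqP czy _]].
  by rewrite cxz czy eqxx in cxy.
congr (_%:R); rewrite -[RHS](netf ij x (f i x) (f j y)); apply: eq_card => z.
by rewrite !inE /par /= -cxy [c z == _]eq_sym [f i z == _]eq_sym; case: eqP => //=.
Qed.

Let MMid i : M i *m M i = q *: M i.
Proof.
rewrite adjmx_mul; apply/matrixP => a b; rewrite !mxE /=.
set x := enum_val a; set y := enum_val b.
have [pxy|npar] := boolP (par i x y).
  have /andP[/eqP cxy /eqP fxy] := pxy.
  rewrite mulr1 /q -(card_line i x); congr (_%:R); apply: eq_card => z.
  by rewrite !inE /par /= -cxy -fxy [c z == _]eq_sym [f i z == _]eq_sym andbb.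
rewrite mulr0 eq_card0 // => z; rewrite !inE; apply: contraNF npar.
move=> /andP[/andP[/eqP cxz /eqP fxz] /andP[/eqP czy /eqP fzy]].
by rewrite /par /= cxz czy fxz fzy !eqxx.
Qed.

Let MJ i : M i *m J = q *: J.
Proof.
rewrite adjmx_mul; apply/matrixP => a b; rewrite !mxE /=.
set x := enum_val a; set y := enum_val b.
case: (eqVneq (c x) (c y)) => cxy; last first.
  rewrite eq_card0 ?mulr0 // => z; rewrite !inE; apply/negP => /andP[/andP[/eqP cxz _] /eqP czy].
  by rewrite cxz czy eqxx in cxy.
rewrite mulr1 /q -(card_line i x); congr (_%:R); apply: eq_card => z.
by rewrite !inE /par /= -cxy [c z == _]eq_sym; case: eqP => //=; rewrite andbT.
Qed.

(** Expand the square of [\sum_i M i]: the terms with equal indices give the first summand, the m(m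
    - 1) mixed ones give copies of [J]. *)
Let sqB : (A + m%:M) *m (A + m%:M) = q *: (A + m%:M) + (m * (m - 1)) *: J.
Proof.
rewrite -sumM mulmx_suml scaler_sumr.
have -> : (m * (m - 1)) *: J = \sum_(i : I) (m - 1) *: J.
  by rewrite sumr_const -scaler_nat scalerA.
rewrite -big_split; apply: eq_bigr => i _ /=; rewrite mulmx_sumr (bigD1 i) //= MMid.
congr (_ + _); rewrite (eq_bigr (fun=> J)); last by move=> j ji; rewrite MM // eq_sym.
rewrite sumr_const -scaler_nat; congr (_ *: _).
by rewrite cardC1 -subn1 natrB // ltnW.
Qed.

Let BJ : (A + m%:M) *m J = (m * q) *: J.
Proof.
rewrite -sumM mulmx_suml (eq_bigr (fun=> q *: J)) => [|i _]; last exact: MJ.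
by rewrite sumr_const -scaler_nat scalerA.
Qed.

(** With B = A + m the factors are B - mq, B - q and B. The last two multiply to a multiple of [J]
    by [sqB], and B - mq kills [J] by [BJ]. *)
Lemma net_graph_annul :
  (A - (m * q - m)%:M) *m (A - (q - m)%:M) *m (A - (- m)%:M) = 0.
Proof.
have BE x : A - (x - m)%:M = A + m%:M - x%:M by rewrite raddfB /= opprB addrAC addrA addrAC.
rewrite !BE raddfN opprK -mulmxA [(_ - q%:M) *m _]mulmxBl sqB mul_scalar_mx [q *: _ + _]addrC addrK.
by rewrite mulmxBl -!scalemxAr BJ mul_scalar_mx subrr.
Qed.

Lemma net_graph_tr : \tr A = 0.
Proof. by rewrite /mxtrace big1 // => i _; rewrite mxE /net_graph /= eqxx. Qed.

Lemma net_graph_tr_sq : \tr (A *m A) = #|T|%:R * (m * (q - 1)).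
Proof.
have trm (x : algC) : \tr (x%:M : 'M[algC]_#|T|) = #|T|%:R * x.
  by rewrite mxtrace_scalar mulr_natl.
have trJ : \tr J = #|T|%:R.
  rewrite /mxtrace (eq_bigr (fun=> 1)) ?sumr_const ?card_ord // => i _.
  by rewrite mxE /= eqxx.
have := congr1 mxtrace sqB.
rewrite mulmxDl !mulmxDr scalar_mxC mul_scalar_mx -scalar_mxM !mxtraceD !mxtraceZ.
rewrite mxtraceD !trm !net_graph_tr trJ mulr0 !add0r addr0 => /(canRL (addrK _)) ->.
by rewrite /m /q; ring.
Qed.

End NetGraph.

Lemma net_graph_cospectral (T : finType) (C C' : eqType) (c : T -> C) (c' : T -> C')
    (I I' K K' : finType) (f : I -> T -> K) (f' : I' -> T -> K') :
  is_net c f -> is_net c' f' -> 1 < #|I| -> 0 < #|K| -> #|I| = #|I'| -> #|K| = #|K'| ->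
  cospectral (net_graph c f) (net_graph c' f').
Proof.
move=> netf netf' I1 K0 II KK; have I'1 : 1 < #|I'| by rewrite -II.
apply: (cospectral_cubic _ (net_graph_annul netf I1)).
(* The roots mq - m, q - m and - m are distinct because m > 1 and q > 0. *)
- have m0 : (#|I|%:R != 0 :> algC)%R by rewrite pnatr_eq0 -lt0n ltnW.
  have q0 : (#|K|%:R != 0 :> algC)%R by rewrite pnatr_eq0 -lt0n.
  have m1 : (#|I|%:R != 1 :> algC)%R by rewrite pnatr_eq1 gtn_eqF.
  have sub (x y z : algC) : (x - z == y - z)%R = (x == y) by apply: (inj_eq (addIr _)).
  have subN (x z : algC) : (x - z == - z)%R = (x == 0%R) by rewrite -{2}[(- z)%R]add0r sub.
  rewrite /= !inE !subN sub negb_or mulf_neq0 // q0 !andbT.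
  by rewrite -subr_eq0 -{2}[#|K|%:R%R]mul1r -mulrBl mulf_neq0 // subr_eq0.
- by rewrite II KK net_graph_annul.
- by rewrite !net_graph_tr.
- by rewrite !net_graph_tr_sq // II KK.
Qed.

(** * Common neighbours of triangles as an isomorphism invariant *)

Section TriangleInvariant.

Definition common_nbrs (T : finType) (e : rel T) x y z :=
  [set w | [&& e x w, e y w & e z w]].

Definition has_triangle (T : finType) (e : rel T) n := exists x y z,
  [/\ e x y, e y z, e x z & #|common_nbrs e x y z| = n].

Lemma has_triangle_iso (T T' : finType) (e : rel T) (e' : rel T') n :
  graph_iso e e' -> has_triangle e n -> has_triangle e' n.
Proof.
move=> [f f_bij fM] [x [y [z [xy yz xz <-]]]]; exists (f x), (f y), (f z).
rewrite !fM xy yz xz; split=> //; rewrite -(card_imset _ (bij_inj f_bij)).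
apply: eq_card => w'; have [g fK gK] := f_bij; rewrite -[w']gK.
by rewrite (mem_imset _ _ (bij_inj f_bij)) !inE !fM.
Qed.

Lemma common_nbrsC12 (T : finType) (e : rel T) x y z : common_nbrs e x y z = common_nbrs e y x z.
Proof. by apply/setP => w; rewrite !inE andbCA. Qed.

Lemma common_nbrsC23 (T : finType) (e : rel T) x y z : common_nbrs e x y z = common_nbrs e x z y.
Proof. by apply/setP => w; rewrite !inE; congr (_ && _); apply: andbC. Qed.

Lemma eq_graph_iso (T : finType) (e e' : rel T) : e =2 e' -> graph_iso e e'.
Proof. by move=> ee'; exists id => [|x y]; [exists id|rewrite ee']. Qed.

Lemma eq_cospectral (T T' : finType) (e1 e2 : rel T) (e1' e2' : rel T') :
  e1 =2 e2 -> e1' =2 e2' -> cospectral e1 e1' = cospectral e2 e2'.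
Proof.
have eq_spec (U : finType) (r s : rel U) : r =2 s -> spectrum r = spectrum s.
  move=> rs; rewrite /spectrum; suff -> : adjmx r = adjmx s by [].
  by apply/matrixP => i j; rewrite !mxE rs.
by move=> /eq_spec e12 /eq_spec e12'; rewrite /cospectral e12 e12'.
Qed.

End TriangleInvariant.

(** * Disjoint copies of a net on a base set *)

Section Fibration.
Variables (T : finType) (C : eqType) (c : T -> C) (B : finType) (pi : T -> B).

(** [pi] maps each fibre of [c] bijectively onto [B]. In the application the fibres are the right
    cosets of [H] and [B] is the plane. *)
Definition fibration := forall x u, #|[pred z | (c z == c x) && (pi z == u)]| = 1.

Hypothesis fib : fibration.

Let fib_inj x y : c x = c y -> pi x = pi y -> x = y.
Proof.
move=> cxy pxy; have /card_le1_eqP := eq_leq (fib x (pi x)).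
by apply; rewrite inE ?cxy ?pxy !eqxx.
Qed.

Let fib_lift x u : exists2 z, c z = c x & pi z = u.
Proof.
have /eqP/card1P[z zE] := fib x u; have := zE z.
by rewrite !inE eqxx => /andP[/eqP cz /eqP pz]; exists z.
Qed.

Variables (I K : finType) (g : I -> B -> K).

Let unit_fibre (u : B) := tt.

Lemma is_net_pullback : is_net unit_fibre g -> is_net c (fun i x => g i (pi x)).
Proof.
move=> netg i j ij x a b; have /eqP/card1P[u uE] := netg i j ij (pi x) a b.
rewrite -(fib x u); apply: eq_card => z; rewrite !inE; congr (_ && _).
by have := uE (pi z); rewrite !inE.
Qed.

Let e := net_graph c (fun i x => g i (pi x)).
Let b := net_graph unit_fibre g.

Let pullbackE x y : c x = c y -> e x y = b (pi x) (pi y).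
Proof.
move=> cxy; rewrite /e /b /net_graph /= cxy !eqxx; congr (~~ _ && _).
by apply/eqP/eqP => [-> //|]; apply: fib_inj.
Qed.

Let net_graph_fibre x y : e x y -> c x = c y.
Proof. by case/and3P => _ /eqP. Qed.

Let card_common x y z : c x = c y -> c x = c z ->
  #|common_nbrs e x y z| = #|common_nbrs b (pi x) (pi y) (pi z)|.
Proof.
move=> cxy cxz; have in_fibre w : w \in common_nbrs e x y z -> c x = c w.
  by rewrite inE => /and3P[/net_graph_fibre].
rewrite -(card_in_imset (f := pi)); last first.
  by move=> v w /in_fibre cv /in_fibre cw; apply: fib_inj; rewrite -cv.
apply: eq_card => u; apply/imsetP/idP => [[w wN ->]|uN].
  have cw := in_fibre _ wN; move: wN.
  by rewrite !inE !pullbackE // -?cxy -?cxz.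
have [w cw pw] := fib_lift x u; exists w => //.
by move: uN; rewrite !inE -pw !pullbackE // -?cxy -?cxz.
Qed.

(** A triangle and its common neighbours stay in one fibre, which is a copy of the base graph.
    Conversely, a triangle of the base lifts to the fibre of any point [t]. *)
Lemma has_triangle_pullback n : 0 < #|T| -> has_triangle e n <-> has_triangle b n.
Proof.
move=> /card_gt0P[t _]; split=> [[x [y [z [xy yz xz <-]]]]|[u [v [w [uv vw uw <-]]]]].
  have cxy := net_graph_fibre xy; have cxz := net_graph_fibre xz.
  exists (pi x), (pi y), (pi z); rewrite -!pullbackE -?cxy //.
  by split=> //; rewrite card_common.
have [[x cx pu] [y cy pv] [z cz pw]] := And3 (fib_lift t u) (fib_lift t v) (fib_lift t w).
exists x, y, z; rewrite !pullbackE ?cx ?cy ?cz // card_common ?cx ?cy ?cz //.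
by rewrite pu pv pw.
Qed.

End Fibration.

(** By cardinality an injection of [B] into [K * K] is bijective, so lines of different classes meet
    exactly once as soon as they meet at most once. *)
Lemma is_net_of_inj (B I K : finType) (g : I -> B -> K) :
  #|B| = #|K| * #|K| -> (forall i j, i != j -> injective (fun u => (g i u, g j u))) ->
  is_net (fun=> tt) g.
Proof.
move=> cardB g_inj i j ij _ a b.
have [|h gK hK] := inj_card_bij (g_inj i j ij); first by rewrite card_prod cardB.
rewrite -(card1 (h (a, b))); apply: eq_card => u; rewrite !inE /=.
by rewrite -(inj_eq (g_inj i j ij)) hK xpair_eqE.
Qed.

(** * Nets of parallel lines in the affine plane over a finite field *)

Section LinearNet.
Local Open Scope ring_scope.
Variable F : finFieldType.
Implicit Types (c w : F * F) (cs : seq (F * F)).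

Definition dot c w := c.1 * w.1 + c.2 * w.2.

Lemma dotB c u v : dot c (u - v) = dot c u - dot c v.
Proof. rewrite /dot /=; ring. Qed.

(** The entries of [cs] are coefficient vectors of linear forms: the level sets of a form are the
    lines of its class, and its kernel is the line through 0. *)
Definition directions cs : pred (F * F) :=
  [pred w | (w != 0) && has (fun c => dot c w == 0) cs].

Definition linear_classes cs (i : 'I_(size cs)) w := dot (nth 0 cs i) w.

Definition independent : rel (F * F) := [rel c d | c.1 * d.2 - c.2 * d.1 != 0].

(** Cramer's rule: the determinant times either coordinate of [w] is a combination of the two
    forms. *)
Lemma dot_eq0 c d w : independent c d -> dot c w = 0 -> dot d w = 0 -> w = 0.
Proof.
rewrite /independent /dot; case: w => x y /= cd cw dw; apply/eqP; rewrite xpair_eqE.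
apply/andP; split; rewrite -(mulrI_eq0 _ (mulfI cd)); apply/eqP.
  transitivity (d.2 * (c.1 * x + c.2 * y) - c.2 * (d.1 * x + d.2 * y)); first by ring.
  by rewrite cw dw !mulr0 subrr.
transitivity (c.1 * (d.1 * x + d.2 * y) - d.1 * (c.1 * x + c.2 * y)); first by ring.
by rewrite cw dw !mulr0 subrr.
Qed.

Lemma is_net_linear cs : pairwise independent cs -> is_net (fun=> tt) (@linear_classes cs).
Proof.
move=> /(pairwiseP 0) cs_ind; apply: is_net_of_inj => [|i j]; first by rewrite card_prod.
rewrite -val_eqE neq_ltn => ij u v [ui vj]; apply/eqP; rewrite -subr_eq0; apply/eqP.
have dot0 (k : 'I_(size cs)) : @linear_classes cs k u = @linear_classes cs k v ->
    dot (nth 0 cs k) (u - v) = 0.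
  by rewrite /linear_classes dotB => ->; rewrite subrr.
case/orP: ij => ij.
  by apply: (dot_eq0 (cs_ind i j _ _ ij)); rewrite ?inE ?ltn_ord ?dot0.
by apply: (dot_eq0 (cs_ind j i _ _ ij)); rewrite ?inE ?ltn_ord ?dot0.
Qed.

Lemma linear_netE cs u v :
  net_graph (fun=> tt) (@linear_classes cs) u v = (u - v \in directions cs).
Proof.
rewrite /net_graph !inE /= subr_eq0; congr (_ && _).
apply/existsP/hasP => [[i /eqP eqi]|[c /(nthP 0)[k kcs <-]]].
  exists (nth 0 cs i); first by rewrite mem_nth.
  by rewrite dotB subr_eq0; apply/eqP.
by rewrite dotB subr_eq0 => eqk; exists (Ordinal kcs).
Qed.

End LinearNet.

(** * Linear nets on the cosets of [H] as Cayley graphs *)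

Section CayleyNet.
Local Open Scope group_scope.
Variables (gT : finGroupType) (H : {group gT}) (F : finFieldType) (phi : gT -> F * F).

Definition is_coordinate :=
  [/\ {in H &, forall x y, phi (x * y) = (phi x + phi y)%R},
      {in H &, injective phi} & forall u, exists2 h, h \in H & phi h = u].

Hypothesis phiP : is_coordinate.

(** The map [phi] is controlled only on [H], so [x] is first moved into [H] by the representative of
    its coset. *)
Definition coset_coord x := phi (x * (repr (H :* x))^-1).

Let phi1 : phi 1 = 0%R.
Proof. by case: phiP => M _ _; apply: (addrI (phi 1)); rewrite -M // mulg1 addr0. Qed.

Let phiV : {in H, forall h, phi h^-1 = (- phi h)%R}.
Proof.
by case: phiP => M _ _ h hH; apply: (addrI (phi h)); rewrite -M ?groupV // mulgV subrr.
Qed.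

Let coordH x : x * (repr (H :* x))^-1 \in H.
Proof. by rewrite -mem_rcoset rcoset_sym mem_repr_rcoset. Qed.

Lemma coset_fibration : fibration (fun x => H :* x) coset_coord.
Proof.
move=> x u; have [_ injphi /(_ u)[h hH <-]] := phiP.
(* The point of the coset of [x] with coordinate [phi h] is [h] times the coset representative. *)
rewrite -(card1 (h * repr (H :* x))); apply: eq_card => z; rewrite !inE.
apply/andP/eqP => [[/eqP zx /eqP]|->].
  rewrite /coset_coord zx => /injphi <-; rewrite ?mulgKV // -zx; exact: coordH.
have hx : H :* (h * repr (H :* x)) = H :* x.
  by rewrite rcosetM rcoset_id // rcoset_repr.
by rewrite /coset_coord hx mulgK !eqxx.
Qed.

Definition connection_set cs := [set h in H | phi h \in directions cs].

Lemma connection_set_cayley cs : cayley_set (connection_set cs).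
Proof.
split; first by rewrite inE phi1 !inE eqxx andbF.
apply/setP => h; rewrite !inE groupV; case hH: (h \in H) => //=.
rewrite phiV // oppr_eq0; congr (_ && _); apply: eq_has => d.
by rewrite -[(- phi h)%R]sub0r dotB subr_eq0 eq_sym /dot !mulr0 addr0.
Qed.

(** Within a coset the representative cancels, so the difference of the coordinates is
    [phi (a * b^-1)]; across cosets neither graph has an edge. *)
Lemma Cay_connection_set cs : Cay (connection_set cs) =2
  net_graph (fun x => H :* x) (fun i x => @linear_classes F cs i (coset_coord x)).
Proof.
move=> a b; have [M _ _] := phiP; rewrite /Cay /= inE -mem_rcoset.
have [ab|nab] := boolP (a \in _); last first.
  rewrite /net_graph /=; case: (H :* a =P H :* b) => [/rcoset_eqP|]; last by rewrite andbF.
  by rewrite (negPf nab).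
have cab := rcoset_eqP ab.
have := linear_netE cs (coset_coord a) (coset_coord b).
have -> : (coset_coord a - coset_coord b)%R = phi (a * b^-1).
  rewrite /coset_coord -cab -phiV ?cab // -M ?groupV //; last by rewrite -cab.
  by congr phi; rewrite invMg invgK mulgA mulgKV.
move=> <-; rewrite /net_graph /= cab !eqxx /=; congr (~~ _ && _).
apply/eqP/eqP => [eqc|-> //]; have /card_le1_eqP := eq_leq (coset_fibration a (coset_coord a)).
by apply; rewrite inE ?cab ?eqc !eqxx.
Qed.

End CayleyNet.

(** * Collinear triangles in linear nets *)

Section LinearTriangles.
Local Open Scope ring_scope.
Variable F : finFieldType.
Implicit Types (c u v w x y z : F * F) (cs : seq (F * F)) (k : F).

Definition linear_net cs : rel (F * F) := net_graph (fun=> tt) (@linear_classes F cs).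

Definition dilate k u : F * F := (k * u.1, k * u.2).

Lemma dot_dilate c k u : dot c (dilate k u) = k * dot c u.
Proof. rewrite /dot /dilate /=; ring. Qed.

Lemma dilate_eq0 k u : (dilate k u == 0) = (k == 0) || (u == 0).
Proof. by case: u => a b; rewrite !xpair_eqE !mulf_eq0; case: eqP. Qed.

Lemma directions_dilate cs k u : k != 0 -> (dilate k u \in directions cs) = (u \in directions cs).
Proof.
move=> k0; rewrite !inE dilate_eq0 (negPf k0); congr (_ && _); apply: eq_has => c.
by rewrite dot_dilate mulf_eq0 (negPf k0).
Qed.

Lemma directionsN cs u : (- u \in directions cs) = (u \in directions cs).
Proof.
rewrite -(@directions_dilate cs (-1) u) ?oppr_eq0 ?oner_eq0 //.
by case: u => a b; rewrite /dilate /= !mulN1r.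
Qed.

Definition det2 u v := u.1 * v.2 - u.2 * v.1.

Lemma det2_dot0 c u v : c != 0 -> dot c u = 0 -> dot c v = 0 -> det2 u v = 0.
Proof.
case: c => c1 c2; rewrite xpair_eqE negb_and /dot /det2 /= => c0 cu cv.
case/orP: c0 => c0; apply: (mulfI c0); rewrite mulr0.
  transitivity (v.2 * (c1 * u.1 + c2 * u.2) - u.2 * (c1 * v.1 + c2 * v.2)); first by ring.
  by rewrite cu cv !mulr0 subrr.
transitivity (u.1 * (c1 * v.1 + c2 * v.2) - v.1 * (c1 * u.1 + c2 * u.2)); first by ring.
by rewrite cu cv !mulr0 subrr.
Qed.

Lemma det2_eq0 u v : u != 0 -> det2 u v = 0 -> exists k, v = dilate k u.
Proof.
case: u v => [u1 u2] [v1 v2]; rewrite xpair_eqE negb_and /det2 /= => u0 /eqP.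
rewrite subr_eq0 => /eqP uv; case/orP: u0 => u0.
  by exists (v1 / u1); rewrite /dilate /= divfK // mulrAC [v1 * _]mulrC -uv mulrAC mulfV ?mul1r.
by exists (v2 / u2); rewrite /dilate /= divfK // mulrAC [v2 * _]mulrC uv mulrAC mulfV ?mul1r.
Qed.

(** The vertices lie on a line of the net, and its other points are adjacent to all three. *)
Lemma collinear_common_nbrs cs x y z :
  x - y \in directions cs -> det2 (x - y) (x - z) = 0 ->
  (#|F| - 3 <= #|common_nbrs (linear_net cs) x y z|)%N.
Proof.
move=> a_dir; have a0 : x - y != 0 by case/andP: a_dir.
move=> /(det2_eq0 a0)[t zE].
(* The line is parametrized by [x - dilate s (x - y)]; the vertices have parameters 0, 1 and [t]. *)
have zE' : z = x - dilate t (x - y) by rewrite -zE subKr.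
have yE : y = x - dilate 1 (x - y) by rewrite /dilate !mul1r -surjective_pairing subKr.
have xE : x = x - dilate 0 (x - y) by rewrite /dilate !mul0r subr0.
have inj_pt : injective (fun s => x - dilate s (x - y)).
  move=> s s' /addrI/oppr_inj/eqP; rewrite -subr_eq0 => /eqP ss'.
  have : dilate (s - s') (x - y) = 0 by rewrite -ss' /dilate /= !mulrBl.
  by move=> /eqP; rewrite dilate_eq0 (negPf a0) orbF subr_eq0 => /eqP.
have card3 : (#|F| - 3 <= #|~: [set 0%R; 1%R; t]|)%N.
  rewrite cardsCs setCK leq_sub2l // (leq_trans (leq_card_setU _ _)) // cards1 cards2.
  by case: eqP.
apply: (leq_trans card3); rewrite -(card_imset _ inj_pt); apply: subset_leq_card.
apply/subsetP => _ /imsetP[s + ->]; rewrite !inE !negb_or -andbA => /and3P[s0 s1 st].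
have adj r : s != r -> linear_net cs (x - dilate r (x - y)) (x - dilate s (x - y)).
  move=> sr; rewrite /linear_net linear_netE.
  have -> : x - dilate r (x - y) - (x - dilate s (x - y)) = dilate (s - r) (x - y).
    by apply: injective_projections => /=; ring.
  by rewrite directions_dilate // subr_eq0.
by apply/and3P; split; [rewrite {1}xE|rewrite {1}yE|rewrite {1}zE']; apply: adj.
Qed.

End LinearTriangles.

(** Puts a nonzero vector on the line of a chosen form by exhibiting the value of the form as 1, -1,
    2 or -2 times the expression that vanishes by [e]. *)
Local Ltac solve_dir dir S m multiple e :=
  apply: (dir _ _ S m);
  first [apply: (multiple 1%R _ _ e); rewrite /dot /=; ring
        |apply: (multiple (-1)%R _ _ e); rewrite /dot /=; ring
        |apply: (multiple 2%R _ _ e); rewrite /dot /=; ring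
        |apply: (multiple (-2)%R _ _ e); rewrite /dot /=; ring].

(** * Four directions: harmonic and non-harmonic cross-ratio *)

Section FourDirections.
Local Open Scope ring_scope.
Variable F : finFieldType.
Hypotheses (two_neq0 : 2 != 0 :> F) (three_neq0 : 3 != 0 :> F).
Implicit Types (c u v w x y z : F * F) (cs : seq (F * F)) (k : F).

Lemma det2_neq0r u v : det2 u v != 0 -> v != 0.
Proof. by apply: contra_neq => ->; rewrite /det2 /=; ring. Qed.

Lemma det2_neq0l u v : det2 u v != 0 -> u != 0.
Proof. by apply: contra_neq => ->; rewrite /det2 /=; ring. Qed.

Lemma in_directions cs c u : u != 0 -> c \in cs -> dot c u = 0 -> u \in directions cs.
Proof. by move=> u0 ccs cu; rewrite inE u0; apply/hasP; exists c => //; apply/eqP. Qed.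

(* The common neighbours are [z + P + Q], [z + (P + Q) / 2], [z - P] and [z - Q]. *)
Lemma parallelogram_common_nbrs cs z P Q :
  P \in directions cs -> Q \in directions cs -> P - Q \in directions cs ->
  P + Q \in directions cs -> det2 P Q != 0 ->
  (4 <= #|common_nbrs (linear_net cs) (z + P)%R (z + Q)%R z|)%N.
Proof.
move=> dP dQ dB dD PQ.
have [h h2] : exists h : F, 2 * h = 1 by exists 2^-1; rewrite divff.
have h0 : h != 0 by apply: contra_eq_neq h2 => ->; rewrite mulr0 eq_sym oner_eq0.
pose W := [:: P + Q; dilate h (P + Q); - P; - Q].
have W_uniq : uniq [seq z + w | w <- W].
  (* The form [det2 P] separates the four points: its values are 1, 1/2, 0 and -1 times [det2 P Q],
     and these are distinct when 2 and 3 are nonzero. *)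
  rewrite (map_inj_uniq (addrI z)); apply: (@map_uniq _ _ (det2 P)).
  have -> : [seq det2 P w | w <- W] = [seq k * det2 P Q | k <- [:: 1; h; 0; -1]].
    rewrite /= /det2 /dilate /=; congr [:: _; _; _; _]; ring.
  rewrite (map_inj_uniq (mulIf PQ)) /= !inE !negb_or.
  have h1 : 1 != h.
    apply: contra_eq_neq h2 => <-; rewrite -subr_eq0.
    by have -> : 2 * 1 - 1 = 1 :> F by [ring]; rewrite oner_eq0.
  have hN1 : h != -1.
    apply: contra_eq_neq h2 => ->; rewrite -subr_eq0.
    by have -> : 2 * -1 - 1 = - 3 :> F by [ring]; rewrite oppr_eq0.
  have N1 : 1 != -1 :> F by rewrite -subr_eq0 opprK.
  by rewrite h1 hN1 N1 h0 oner_eq0 eq_sym oppr_eq0 oner_eq0.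
have dil k u v : k != 0 -> u \in directions cs -> v = dilate k u -> v \in directions cs.
  by move=> k0 du ->; rewrite directions_dilate.
have n1 : -1 != 0 :> F by rewrite oppr_eq0 oner_eq0.
have n2 : -2 != 0 :> F by rewrite oppr_eq0.
have adj r w : w - r \in directions cs -> linear_net cs (z + r) (z + w).
  by rewrite /linear_net linear_netE opprD addrACA subrr add0r -directionsN opprB.
have step w : w \in directions cs -> w - P \in directions cs -> w - Q \in directions cs ->
    [&& linear_net cs (z + P) (z + w), linear_net cs (z + Q) (z + w) & linear_net cs z (z + w)].
  by move=> dw dwP dwQ; rewrite !adj // -{1}[z]addr0 adj // subr0.
have hhE a : h * a + h * a = a by rewrite -mulrDl -mulr2n -mulr_natl h2 mul1r.
suff /subset_leq_card : [set w in [seq z + w | w <- W]] \subset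
    common_nbrs (linear_net cs) (z + P) (z + Q) z.
  by rewrite cardsE (card_uniqP W_uniq) size_map.
have hE a b : h * (a + b) - a = h * (b - a).
  by rewrite -{2}[a]hhE; ring.
have pair_eq u v : u.1 = v.1 -> u.2 = v.2 -> u = v by apply: injective_projections.
(* For each candidate [w], the vectors [w], [w - P] and [w - Q] are multiples of [P], [Q], [P - Q]
   or [P + Q]. *)
apply/subsetP => w; rewrite !inE => /or4P[]/eqP->; apply: step.
- by [].
- by apply: (dil 1 _ _ _ dQ); rewrite ?oner_eq0 //; apply: pair_eq => /=; ring.
- by apply: (dil 1 _ _ _ dP); rewrite ?oner_eq0 //; apply: pair_eq => /=; ring.
- exact: (dil h _ _ _ dD).
- by apply: (dil (- h) _ _ _ dB); rewrite ?oppr_eq0 //; apply: pair_eq => /=; rewrite hE; ring.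
- by apply: (dil h _ _ _ dB) => //; apply: pair_eq => /=; rewrite [X in h * X - _]addrC hE.
- by rewrite directionsN.
- by apply: (dil (-2) _ _ _ dP) => //; apply: pair_eq => /=; ring.
- by apply: (dil (-1) _ _ _ dD) => //; apply: pair_eq => /=; ring.
- by rewrite directionsN.
- by apply: (dil (-1) _ _ _ dD) => //; apply: pair_eq => /=; ring.
- by apply: (dil (-2) _ _ _ dQ) => //; apply: pair_eq => /=; ring.
Qed.

(** The kernels have slopes infinity, 0, 1 and -1, with cross-ratio -1. *)
Definition harmonic : seq (F * F) := [:: (1, 0); (0, 1); (1, -1); (1, 1)].

Lemma harmonic_direction u : u \in directions harmonic ->
  exists t, [\/ u = (0, t), u = (t, 0), u = (t, t) | u = (t, - t)].
Proof.
case: u => a b; rewrite inE /= orbF /dot /= => /andP[_ /or4P[]/eqP].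
- by rewrite mul1r mul0r addr0 => ->; exists b; constructor 1.
- by rewrite mul1r mul0r add0r => ->; exists a; constructor 2.
- by rewrite mul1r mulN1r => /eqP; rewrite subr_eq0 => /eqP->; exists b; constructor 3.
- rewrite !mul1r addrC => /eqP; rewrite addr_eq0 => /eqP->; exists a; by constructor 4.
Qed.

(* Each alternative designates the vertex (0, P or Q) of the triangle 0, P, Q that
   is opposite to the side serving as a diagonal of the parallelogram. *)
Lemma harmonic_cases P Q :
  P \in directions harmonic -> Q \in directions harmonic -> P - Q \in directions harmonic ->
  det2 P Q != 0 ->
  [\/ P + Q \in directions harmonic, (Q - P) - P \in directions harmonic
    | (P - Q) - Q \in directions harmonic].
Proof.
move=> /harmonic_direction[p dP] /harmonic_direction[q dQ] /andP[_ /hasP[e eH /eqP ePQ]] PQ.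
have e0 : e != 0 by move: eH; rewrite !inE => /or4P[]/eqP->; rewrite xpair_eqE ?oner_eq0 ?andbF.
(* The side [P - Q] lies in the kernel of [e]; if [P] or [Q] did too, the triangle would be
   degenerate. *)
have eP : dot e P != 0.
  apply: contraNneq PQ => eP; apply/eqP/(det2_dot0 e0 eP).
  by move: ePQ; rewrite dotB eP sub0r => /eqP; rewrite oppr_eq0 => /eqP.
have eQ : dot e Q != 0.
  by apply: contraNneq eP => eQ; move: ePQ; rewrite dotB eQ subr0 => ->.
have S0 : P + Q != 0.
  by apply: (@det2_neq0r P); have -> : det2 P (P + Q) = det2 P Q by rewrite /det2 /=; ring.
have S1 : Q - P - P != 0.
  apply: (@det2_neq0r P).
  by have -> : det2 P (Q - P - P) = det2 P Q by rewrite /det2 /=; ring.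
have S2 : P - Q - Q != 0.
  apply: (@det2_neq0l _ Q).
  by have -> : det2 (P - Q - Q) Q = det2 P Q by rewrite /det2 /=; ring.
have dir v u : u != 0 -> v \in harmonic -> dot v u = 0 -> u \in directions harmonic.
  exact: in_directions.
have m1 : (1, 0) \in harmonic by rewrite !inE eqxx.
have m2 : (0, 1) \in harmonic by rewrite !inE eqxx orbT.
have m3 : (1, -1) \in harmonic by rewrite !inE eqxx !orbT.
have m4 : (1, 1) \in harmonic by rewrite !inE eqxx !orbT.
have multiple k X g : X = 0 -> g = k * X -> g = 0 :> F by move=> -> ->; rewrite mulr0.
have {}eH : [\/ e = (1, 0), e = (0, 1), e = (1, -1) | e = (1, 1)].
  move: eH; rewrite !inE => /or4P[]/eqP->.
  - by constructor 1.
  - by constructor 2.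
  - by constructor 3.
  - by constructor 4.
(* Only the cases where the three sides have distinct directions survive; in each, one of the three
   diagonals is found to lie on a line of the net. *)
case: dP PQ eP ePQ S0 S1 S2 => -> PQ eP ePQ S0 S1 S2;
  case: dQ PQ eQ ePQ S0 S1 S2 => -> PQ eQ ePQ S0 S1 S2;
  try by [case/eqP: PQ; rewrite /det2 /=; ring].
all: case: eH eP eQ ePQ => -> eP eQ ePQ;
  try by [case/eqP: eP; rewrite /dot /=; ring]; try by [case/eqP: eQ; rewrite /dot /=; ring].
all: by first
  [constructor 1; solve_dir dir S0 m1 multiple ePQ
  |constructor 1; solve_dir dir S0 m2 multiple ePQ
  |constructor 1; solve_dir dir S0 m3 multiple ePQ
  |constructor 1; solve_dir dir S0 m4 multiple ePQ
  |constructor 2; solve_dir dir S1 m1 multiple ePQ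
  |constructor 2; solve_dir dir S1 m2 multiple ePQ
  |constructor 2; solve_dir dir S1 m3 multiple ePQ
  |constructor 2; solve_dir dir S1 m4 multiple ePQ
  |constructor 3; solve_dir dir S2 m1 multiple ePQ
  |constructor 3; solve_dir dir S2 m2 multiple ePQ
  |constructor 3; solve_dir dir S2 m3 multiple ePQ
  |constructor 3; solve_dir dir S2 m4 multiple ePQ].
Qed.

Lemma harmonic_triangles n : (6 < #|F|)%N ->
  has_triangle (linear_net harmonic) n -> (4 <= n)%N.
Proof.
move=> F_gt6 [x [y [z []]]]; rewrite /linear_net !linear_netE => xy yz xz <-.
have [zc|nc] := eqVneq (det2 (x - y) (x - z)) 0.
  by apply: leq_trans (collinear_common_nbrs xy zc); rewrite ltn_subRL.
have detE : det2 (x - z) (y - z) = det2 (x - y) (x - z) by rewrite /det2 /=; ring.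
have addz u v : v + (u - v) = u by rewrite addrC subrK.
have dirB u v : u - v \in directions harmonic -> v - u \in directions harmonic.
  by rewrite -directionsN opprB.
have subE u v w : (u - w) - (v - w) = u - v by rewrite opprB addrA subrK.
(* With [z] as origin, the three alternatives complete the parallelogram from the vertex [z], [x] or
   [y]. *)
have [] := @harmonic_cases (x - z) (y - z); rewrite ?subE ?detE // => dS.
- have := parallelogram_common_nbrs z xz yz; rewrite subE !addz; apply; rewrite ?detE //.
- have := parallelogram_common_nbrs x (dirB _ _ xy) (dirB _ _ xz); rewrite subE !addz.
  rewrite common_nbrsC23 common_nbrsC12; apply=> //; first by move: dS; rewrite opprB.
  by have -> : det2 (y - x) (z - x) = det2 (x - y) (x - z) by rewrite /det2 /=; ring.
- have := parallelogram_common_nbrs y xy (dirB _ _ yz); rewrite subE !addz.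
  rewrite common_nbrsC23; apply=> //; first by move: dS; rewrite opprB.
  have -> : det2 (x - y) (z - y) = - det2 (x - y) (x - z).
    by rewrite /det2 /=; ring.
  by rewrite oppr_eq0.
Qed.

Definition anharmonic : seq (F * F) := [:: (1, 0); (0, 1); (1, -1); (3, -1)].

Lemma anharmonic_direction a b : (a, b) \in directions anharmonic ->
  (a, b) != 0 /\ [\/ a = 0, b = 0, a = b | b = 3 * a].
Proof.
rewrite inE /= orbF /dot /= => /andP[-> /or4P ab]; split=> //.
case: ab => /eqP; rewrite ?mul1r ?mul0r ?addr0 ?add0r ?mulN1r.
- by constructor 1.
- by constructor 2.
- by move=> /eqP; rewrite subr_eq0 => /eqP; constructor 3.
- by move=> /eqP; rewrite subr_eq0 => /eqP; constructor 4.
Qed.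

(** The point lies on a line of the net through each vertex of the triangle (0, 0), (1, 0), (1, 1).
    Every other choice of the three lines makes it a vertex or forces one of 1, 2, 3, 4, 5 to
    vanish. *)
Lemma anharmonic_solutions s t : 5 != 0 :> F ->
  (s, t) - 0 \in directions anharmonic -> (s, t) - (1, 0) \in directions anharmonic ->
  (s, t) - (1, 1) \in directions anharmonic ->
  (s, t) \in [set (2 / 3, 0); (3 / 2, 3 / 2); (1, 3)].
Proof.
move=> five_neq0 /anharmonic_direction[/= n0 wx] /anharmonic_direction[/= n1 wy].
move=> /anharmonic_direction[/= n2 wz]; move: n0 n1 n2 wx wy wz.
rewrite !xpair_eqE !subr0 !subr_eq0 => n0 n1 n2 wx wy wz.
have absurd (a b m k : F) (G : Prop) : k != 0 -> a = b -> m * (a - b) = k -> G.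
  by move=> k0 -> E; move: k0; rewrite -E subrr mulr0 eqxx.
have one_neq0 := oner_eq0 F; move/negbT: one_neq0 => one_neq0.
rewrite !inE !xpair_eqE.
have four_neq0 : 4 != 0 :> F by have -> : 4 = 2 * 2 :> F by [ring]; rewrite mulf_neq0.
case: wx => [s0|t0|st|ts].
- rewrite s0 eqxx /= in n0 wy wz *.
  case: wy => [E|t0|tE|tE].
  + by apply: (absurd _ _ (-1) _ _ one_neq0 E); ring.
  + by rewrite t0 eqxx in n0.
  + rewrite -tE in wz; case: wz => E.
    * by apply: (absurd _ _ (-1) _ _ one_neq0 E); ring.
    * by apply: (absurd _ _ (-1) _ _ two_neq0 E); ring.
    * by apply: (absurd _ _ 1 _ _ one_neq0 E); ring.
    * by apply: (absurd _ _ 1 _ _ one_neq0 E); ring.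
  + rewrite tE in wz; case: wz => E.
    * by apply: (absurd _ _ (-1) _ _ one_neq0 E); ring.
    * by apply: (absurd _ _ (-1) _ _ four_neq0 E); ring.
    * by apply: (absurd _ _ 1 _ _ three_neq0 E); ring.
    * by apply: (absurd _ _ (-1) _ _ one_neq0 E); ring.
- rewrite t0 eqxx ?andbT /= in n0 n1 wz *.
  case: wz => E.
  + by rewrite (subr0_eq E) eqxx in n1.
  + by apply: (absurd _ _ (-1) _ _ one_neq0 E); ring.
  + by rewrite (addIr _ E) eqxx in n0.
  + suff -> : s = 2 / 3 by rewrite eqxx.
    apply: (mulfI three_neq0); rewrite mulrCA mulfV // mulr1.
    by apply/eqP; rewrite -subr_eq0 -(subrr (0 - 1)) {1}E; apply/eqP; ring.
- rewrite st in n0 n2 wy *; case: wy => E.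
  + by rewrite (subr0_eq E) eqxx in n2.
  + by rewrite E eqxx in n0.
  + by apply: (absurd _ _ (-1) _ _ one_neq0 E); ring.
  + suff -> : t = 3 / 2 by rewrite eqxx orbT.
    apply: (mulfI two_neq0); rewrite mulrCA mulfV // mulr1.
    by transitivity (3 * t - t); [ring|rewrite {2}E; ring].
- rewrite ts in n0 wy wz *; case: wy => E.
  + by rewrite (subr0_eq E) mulr1 !eqxx !orbT.
  + move: n0; rewrite E eqxx andbT; move/eqP: E; rewrite mulf_eq0 (negPf three_neq0) => /= ->.
    by [].
  + case: wz => E'.
    * by rewrite (subr0_eq E') in E; apply: (absurd _ _ (-1) _ _ three_neq0 E); ring.
    (* Eliminating [s] from s - 1 = 3s and 3s = 1 leaves 5 = 0. In characteristic 5 the cross-ratio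
       3 is 1/2, hence harmonic. *)
    * have E2 : 3 * (s - 1) + 2 * (3 * s - 1) = 3 * (3 * s) by rewrite E E' mulr0 addr0.
      by apply: (absurd _ _ (-1) _ _ five_neq0 E2); ring.
    * by move: E'; rewrite E => E'; apply: (absurd _ _ 1 _ _ one_neq0 E'); ring.
    * by apply: (absurd _ _ 1 _ _ two_neq0 E'); ring.
  + by apply: (absurd _ _ 1 _ _ three_neq0 E); ring.
Qed.

Lemma anharmonic_triangle : 5 != 0 :> F ->
  exists2 n, (n < 4)%N & has_triangle (linear_net anharmonic) n.
Proof.
move=> five_neq0; pose x : F * F := (0, 0); pose y : F * F := (1, 0); pose z : F * F := (1, 1).
exists #|common_nbrs (linear_net anharmonic) x y z|; last first.
  exists x, y, z; rewrite /linear_net !linear_netE; split=> //.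
  - apply: (in_directions (c := (0, 1))); rewrite ?inE ?eqxx ?orbT /dot /= //; last by ring.
    by rewrite xpair_eqE sub0r oppr_eq0 oner_eq0.
  - apply: (in_directions (c := (1, 0))); rewrite ?inE ?eqxx ?orbT /dot /= //; last by ring.
    by rewrite xpair_eqE sub0r oppr_eq0 oner_eq0 andbF.
  - apply: (in_directions (c := (1, -1))); rewrite ?inE ?eqxx ?orbT /dot /= //; last by ring.
    by rewrite xpair_eqE sub0r oppr_eq0 oner_eq0.
apply: (@leq_trans #|[set (2 / 3, 0); (3 / 2, 3 / 2); (1 : F, 3 : F)]|.+1).
  rewrite ltnS; apply/subset_leq_card/subsetP => -[s t].
  rewrite inE /linear_net !linear_netE => /and3P[].
  by rewrite -!(directionsN _ (_ - _)) !opprB => wx wy wz; apply: anharmonic_solutions.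
rewrite ltnS (leq_trans (leq_card_setU _ _)) // cards1 cards2; by case: eqP.
Qed.

End FourDirections.

(** * The Latin square graph of the addition table *)

Section ThreeDirections.
Local Open Scope ring_scope.
Variable F : finFieldType.
Hypothesis two_neq0 : 2 != 0 :> F.
Implicit Types (x y z w : F * F).

(** The three forms give the row, the column and the symbol of a cell in the addition table of
    [F]. *)
Definition group_square : seq (F * F) := [:: (1, 0); (0, 1); (1, 1)].

Lemma group_square_directionE u v : u - v \in directions group_square ->
  u <> v /\ [\/ u.1 = v.1, u.2 = v.2 | u.1 + u.2 = v.1 + v.2].
Proof.
rewrite inE subr_eq0 => /andP[/eqP uv]; rewrite /= orbF !dotB !subr_eq0 /dot /=.
rewrite !mul1r !mul0r !addr0 !add0r => /or3P uv'; split=> //.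
by case: uv' => /eqP; [constructor 1|constructor 2|constructor 3].
Qed.

(** The only serious candidate for [w] is the fourth corner of the rectangle [x], [z], [y]. It would
    close a 2 x 2 subsquare, forcing 2(x.2 - y.2) = 0. *)
Lemma group_square_no_K4 x y z w : x <> y ->
  x.1 = z.1 -> y.2 = z.2 -> x.1 + x.2 = y.1 + y.2 ->
  x - w \in directions group_square -> y - w \in directions group_square ->
  z - w \notin directions group_square.
Proof.
case: x y z w => [x1 x2] [y1 y2] [z1 z2] [w1 w2] /= xy <- <- xyE.
have y1E : y1 = x1 + x2 - y2 by rewrite xyE addrK.
have x2y2 : x2 <> y2 by move=> E; apply: xy; rewrite y1E E addrK.
move=> /group_square_directionE[/= xw wx] /group_square_directionE[/= yw wy].
apply/negP => /group_square_directionE[/= zw]; case=> wz.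
- rewrite -wz in xw zw wx wy *; case: wy => E; rewrite ?E in zw *.
  + by apply: x2y2; apply: (addrI x1); rewrite xyE E.
  + by [].
  + by apply: xw; congr (_, _); apply: (addrI x1); rewrite -E.
- rewrite -wz in yw zw wx wy *; case: wx => E.
  + by apply: zw; rewrite E.
  + by [].
  + by apply: yw; congr (_, _); apply: (addIr y2); rewrite -E.
- case: wx => E.
  + by apply: zw; rewrite -E in wz *; rewrite (addrI _ wz).
  + have w1E : w1 = x1 + y2 - x2 by rewrite wz -E addrK.
    case: wy => E'.
    * have : 2 * (x2 - y2) = 0.
        by transitivity ((x1 + x2 - y2) - (x1 + y2 - x2)); [ring|rewrite -w1E -E' y1E subrr].
      by move/eqP; rewrite mulf_eq0 (negPf two_neq0) subr_eq0 => /eqP.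
    * by apply: x2y2; rewrite E E'.
    * by apply: x2y2; apply: (addrI x1); rewrite wz -E' -xyE.
  + by apply: x2y2; apply: (addrI x1); rewrite wz -E.
Qed.

Lemma group_square_triangles n : (4 < #|F|)%N ->
  has_triangle (linear_net group_square) n -> n != 1%N.
Proof.
move=> F_gt4 [x [y [z []]]]; rewrite /linear_net !linear_netE => xy yz xz <-.
have [zc|nc] := eqVneq (det2 (x - y) (x - z)) 0.
  rewrite neq_ltn; apply/orP; right.
  by apply: leq_trans (collinear_common_nbrs xy zc); rewrite ltn_subRL.
(* Collinear triangles have at least two common neighbours; the others are shown to have none. *)
rewrite neq_ltn ltnS leqn0 cards_eq0; apply/orP; left; apply/eqP/setP => w; rewrite !inE.
rewrite /linear_net !linear_netE; apply/negP => /and3P[xw yw zw].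
have [[xy' cxy] [yz' cyz] [xz' cxz]] := And3 (group_square_directionE xy)
  (group_square_directionE yz) (group_square_directionE xz).
have nK4 x' y' z' := @group_square_no_K4 x' y' z' w.
have deg c : c != 0 -> dot c x = dot c y -> dot c x = dot c z -> False.
  by move=> c0 E1 E2; case/eqP: nc; apply: (det2_dot0 c0); rewrite dotB ?E1 -?E2 ?E1 subrr.
have deg1 : x.1 = y.1 -> x.1 = z.1 -> False.
  by move=> E1 E2; apply: (deg (1, 0)); rewrite /dot /= ?xpair_eqE ?oner_eq0 // !mul0r ?E1 -?E2 ?E1.
have deg2 : x.2 = y.2 -> x.2 = z.2 -> False.
  by move=> E1 E2; apply: (deg (0, 1));
    rewrite /dot /= ?xpair_eqE ?oner_eq0 ?andbF // !mul0r ?E1 -?E2 ?E1.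
have deg3 : x.1 + x.2 = y.1 + y.2 -> x.1 + x.2 = z.1 + z.2 -> False.
  by move=> E1 E2; apply: (deg (1, 1)); rewrite /dot /= ?xpair_eqE ?oner_eq0 // !mul1r.
have [yx' zy' zx'] := And3 (nesym xy') (nesym yz') (nesym xz').
(* If two sides are in one class, so is the third and the triangle is collinear. The six remaining
   arrangements are relabellings of [group_square_no_K4]. *)
case: cxy => cxy; case: cyz => cyz; case: cxz => cxz;
  first
  [by apply: (deg1 cxy cxz)|by apply: (deg1 cxy (etrans cxy cyz))
  |by apply: (deg1 (etrans cxz (esym cyz)) cxz)
  |by apply: (deg2 cxy cxz)|by apply: (deg2 cxy (etrans cxy cyz))
  |by apply: (deg2 (etrans cxz (esym cyz)) cxz)
  |by apply: (deg3 cxy cxz)|by apply: (deg3 cxy (etrans cxy cyz))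
  |by apply: (deg3 (etrans cxz (esym cyz)) cxz)
  |by case/negP: (nK4 x y z xy' (cxz) (cyz) (cxy) xw yw)
  |by case/negP: (nK4 y x z yx' (cyz) (cxz) (esym cxy) yw xw)
  |by case/negP: (nK4 x z y xz' (cxy) (esym cyz) (cxz) xw zw)
  |by case/negP: (nK4 z x y zx' (esym cyz) (cxy) (esym cxz) zw xw)
  |by case/negP: (nK4 y z x yz' (esym cxy) (esym cxz) (cyz) yw zw)
  |by case/negP: (nK4 z y x zy' (esym cxz) (esym cxy) (esym cyz) zw yw)].
Qed.

End ThreeDirections.

(** * A Latin square of order 5 with a 2 x 2 subsquare *)

Section LatinSquare.

(* The cells (0,0), (0,1), (1,0), (1,1) form a 2 x 2 subsquare, which the
   Cayley table of a group of odd order cannot contain. *)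
Definition latin_table := [:: [:: 0; 1; 2; 3; 4];
                              [:: 1; 0; 3; 4; 2];
                              [:: 2; 3; 4; 0; 1];
                              [:: 3; 4; 1; 2; 0];
                              [:: 4; 2; 0; 1; 3]].

(** Classes 0, 1, 2 are row, column and symbol. Plain natural numbers let the finite checks run by
    [vm_compute]. *)
Definition latin_class (i : nat) (ab : nat * nat) :=
  nth 0 [:: ab.1; ab.2; nth 0 (nth [::] latin_table ab.1) ab.2] i.

Definition nat_coords (u : 'F_5 * 'F_5) : nat * nat := (u.1 : nat, u.2 : nat).

Definition latin_classes (i : 'I_3) u : 'F_5 := inord (latin_class i (nat_coords u)).

Definition latin_net := net_graph (fun=> tt) latin_classes.

Let cells := [seq (a, b) | a <- iota 0 5, b <- iota 0 5].

Let nat_coords_cells u : nat_coords u \in cells.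
Proof. by apply/allpairsP; exists (nat_coords u); rewrite !mem_iota !ltn_ord. Qed.

Let nat_coords_inj : injective nat_coords.
Proof. by move=> [a b] [a' b'] [/val_inj-> /val_inj->]. Qed.

Let latin_class_lt : all (fun u => all (fun i => latin_class i u < 5) (iota 0 3)) cells.
Proof. by vm_compute. Qed.

Let latin_classesE (i : 'I_3) u v :
  (latin_classes i u == latin_classes i v)
    = (latin_class i (nat_coords u) == latin_class i (nat_coords v)).
Proof.
have lt5 w : latin_class i (nat_coords w) < 5.
  have /allP/(_ _ (nat_coords_cells w))/allP := latin_class_lt; apply.
  by rewrite mem_iota ltn_ord.
by rewrite -val_eqE /= !inordK.
Qed.

Let latin_table_inj : all (fun i => all (fun j => (i != j) ==>
  all (fun u => all (fun v => (latin_class i u == latin_class i v) ==>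
    (latin_class j u == latin_class j v) ==> (u == v)) cells) cells) (iota 0 3)) (iota 0 3).
Proof. by vm_compute. Qed.

Lemma is_net_latin : is_net (fun=> tt) latin_classes.
Proof.
apply: is_net_of_inj => [|i j ij u v [/eqP Ei /eqP Ej]]; first by rewrite card_prod.
have mem3 (k : 'I_3) : (k : nat) \in iota 0 3 by rewrite mem_iota ltn_ord.
have /allP/(_ _ (mem3 i))/allP/(_ _ (mem3 j)) := latin_table_inj.
rewrite val_eqE ij => /allP/(_ _ (nat_coords_cells u))/allP/(_ _ (nat_coords_cells v)).
by rewrite -!latin_classesE Ei Ej => /eqP/nat_coords_inj.
Qed.

Let nat_latin_net (u v : nat * nat) :=
  (u != v) && has (fun i => latin_class i u == latin_class i v) (iota 0 3).

Let latin_netE u v : latin_net u v = nat_latin_net (nat_coords u) (nat_coords v).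
Proof.
rewrite /nat_latin_net (inj_eq nat_coords_inj).
rewrite -[LHS]/((u != v) && [exists i, latin_classes i u == latin_classes i v]); congr (_ && _).
apply/existsP/hasP => [[i]|[i i3 E]].
  by rewrite latin_classesE => E; exists (i : nat); rewrite // mem_iota ltn_ord.
by move: i3; rewrite mem_iota => i3; exists (Ordinal i3); rewrite latin_classesE.
Qed.

Let latin_table_common : all (fun w => [&& nat_latin_net (0, 0) w, nat_latin_net (0, 1) w
  & nat_latin_net (1, 0) w] == (w == (1, 1))) cells.
Proof. by vm_compute. Qed.

(** Three cells of the subsquare form the triangle; the fourth is its only common neighbour. *)
Lemma latin_triangle : has_triangle latin_net 1.
Proof.
exists (0, 0)%R, (0, 1)%R, (1, 0)%R; rewrite !latin_netE; split=> //.
apply/eqP/cards1P; exists (1, 1)%R; apply/setP => w; rewrite !inE !latin_netE.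
have /allP/(_ _ (nat_coords_cells w))/eqP := latin_table_common.
by rewrite -(inj_eq nat_coords_inj).
Qed.

End LatinSquare.

(** * Coordinates on the subgroup and comparison of the Cayley graphs *)

Lemma coordinates_Fp (gT : finGroupType) (H : {group gT}) p : prime p ->
  H \isog setX (Zp p) (Zp p) -> exists phi : gT -> 'F_p * 'F_p, is_coordinate H phi.
Proof.
move=> p_pr; rewrite /Zp prime_gt1 // -(Fp_Zcast p_pr) => /isogP[f /injmP f_inj fH].
exists f; split=> // [x y xH yH|u]; first by rewrite morphM.
have : u \in (f @* H)%g by rewrite fH !inE.
by case/morphimP => h _ hH ->; exists h.
Qed.

Section CayleyComparison.
Variables (gT : finGroupType) (H : {group gT}) (F : finFieldType) (phi : gT -> F * F).
Hypothesis phiP : is_coordinate H phi.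

(** The net [g] is arbitrary, so that the second graph can come from another set of directions or
    from the Latin square. *)
Lemma Cay_cospectral cs (I K : finType) (g : I -> F * F -> K) :
  pairwise (@independent F) cs -> is_net (fun=> tt) g -> 1 < size cs ->
  size cs = #|I| -> #|F| = #|K| ->
  cospectral (Cay (connection_set H phi cs))
    (net_graph (fun x => H :* x)%g (fun i x => g i (coset_coord H phi x))).
Proof.
move=> cs_ind netg cs1 sI FK.
rewrite (eq_cospectral (Cay_connection_set phiP cs) (fun _ _ => erefl)).
apply: net_graph_cospectral; rewrite ?card_ord //.
- exact/(is_net_pullback (coset_fibration phiP))/is_net_linear.
- exact: (is_net_pullback (coset_fibration phiP)).
- by apply/card_gt0P; exists 0%R.
Qed.

Lemma has_triangle_Cay cs n :
  has_triangle (Cay (connection_set H phi cs)) n <-> has_triangle (linear_net cs) n.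
Proof.
have gT_gt0 : 0 < #|gT| by apply/card_gt0P; exists 1%g.
have CayE := Cay_connection_set phiP cs.
rewrite -(has_triangle_pullback (coset_fibration phiP) _ n gT_gt0).
split; apply: has_triangle_iso; apply: eq_graph_iso => // x y; exact/esym/CayE.
Qed.

End CayleyComparison.

(** * Cospectral graphs that are not isomorphic *)

Section NotDS.
Variables (gT : finGroupType) (H : {group gT}).

Lemma not_Cay_DS (F : finFieldType) (phi : gT -> F * F) : is_coordinate H phi ->
  (2 != 0 :> F)%R -> (3 != 0 :> F)%R -> (5 != 0 :> F)%R -> 6 < #|F| -> ~ Cay_DS gT.
Proof.
move=> phiP F2 F3 F5 F7 ds.
have hind : pairwise (@independent F) (harmonic F).
  by rewrite /= /independent /= !(mul0r, mulr0, mul1r, mulr1, mulN1r, sub0r,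
    subr0, opprK, oppr_eq0, oner_eq0) /= !andbT.
have aind : pairwise (@independent F) (anharmonic F).
  rewrite /= /independent /= !(mul0r, mulr0, mul1r, mulr1, mulN1r, sub0r,
    subr0, opprK, oppr_eq0, oner_eq0) /= F3.
  by have -> : (-1 + 3 = 2 :> F)%R by [ring]; rewrite F2.
have [n n4 n_tri] := anharmonic_triangle F2 F3 F5.
suff /(has_triangle_Cay phiP)/(harmonic_triangles F2 F3 F7) :
  has_triangle (Cay (connection_set H phi (harmonic F))) n by rewrite leqNgt n4.
(* Both Cayley graphs live on the same group; an isomorphism would carry the triangle with fewer
   than four common neighbours into the harmonic graph. *)
apply: has_triangle_iso (iffRL (has_triangle_Cay phiP _ _) n_tri).
apply: ds; try exact: connection_set_cayley.
rewrite (eq_cospectral (fun _ _ => erefl) (Cay_connection_set phiP _)).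
apply: Cay_cospectral => //; last by rewrite card_ord.
exact: is_net_linear.
Qed.

Lemma not_DS (phi : gT -> 'F_5 * 'F_5) : is_coordinate H phi -> ~ DS gT.
Proof.
move=> phiP ds.
have F2 : (2 != 0 :> 'F_5)%R by [].
have ind : pairwise (@independent 'F_5) (group_square 'F_5) by [].
(* A copy of the Latin square graph on each coset: a simple graph, not claimed to be Cayley, so only
   DS is refuted. *)
pose e := net_graph (fun x => H :* x)%g (fun i x => latin_classes i (coset_coord H phi x)).
have e_tri : has_triangle e 1.
  apply/(has_triangle_pullback (coset_fibration phiP)); last exact: latin_triangle.
  by apply/card_gt0P; exists 1%g.
have e_iso : graph_iso (Cay (connection_set H phi (group_square 'F_5))) e.
  apply: ds.
  - exact: connection_set_cayley.
  - split=> [x y|x]; rewrite /e /net_graph /= ?eqxx // eq_sym [X in _ && (X && _)]eq_sym.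
    by congr [&& _, _ & _]; apply: eq_existsb => i; rewrite eq_sym.
  - apply: Cay_cospectral => //; rewrite ?card_ord //; exact: is_net_latin.
have [f [g fK gK] fM] := e_iso.
have e_iso' : graph_iso e (Cay (connection_set H phi (group_square 'F_5))).
  by exists g => [|x y]; [exists f|rewrite -[in RHS](gK x) -[in RHS](gK y) fM].
have /(has_triangle_Cay phiP)/(group_square_triangles F2) := has_triangle_iso e_iso' e_tri.
by rewrite card_Fp // => /(_ isT).
Qed.

End NotDS.

Theorem theorem3p2 (G : finGroupType) :
  (forall p : nat, prime p -> 5 < p ->
     (exists H : {group G}, H \isog setX (Zp p) (Zp p)) -> ~ Cay_DS G)
  /\ ((exists H : {group G}, H \isog setX (Zp 5) (Zp 5)) -> ~ DS G).
Proof.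
split=> [p p_pr p_gt5 [H /(coordinates_Fp p_pr)[phi phiP]]|[H /coordinates_Fp[]// phi phiP]];
  last exact: not_DS phiP.
(* As 6 is not prime, p is at least 7, which gives a collinear triangle its four further points. *)
have p_gt6 : 6 < p by rewrite ltn_neqAle p_gt5 andbT; apply: contraTneq p_pr => <-.
have small_neq0 k : 0 < k < 6 -> (k%:R != 0 :> 'F_p)%R.
  move=> /andP[k0 k6]; rewrite -(dvdn_pcharf (pchar_Fp p_pr)) gtnNdvd //.
  exact: leq_trans k6 p_gt5.
by apply: (not_Cay_DS phiP); rewrite ?card_Fp //; apply: small_neq0.
Qed.
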